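(* Let $R$ be a commutative unital ring, $\mathcal{A}$ a commutative unital $R$-algebra, $(\mathcal{M},a)$ an anchored $\mathcal{A}$-module, and $(\mathrm{F}\mathcal{M},[-,-]_{\mathrm{Lei}},\mathrm{F}a)$ the free Leibniz pseudoalgebra over $(R,\mathcal{A})$ on $(\mathcal{M},a)$. Put $$J_1=\{X\circ fY-(fX)\circ Y: f\in\mathcal{A},\ X,Y\in\mathrm{F}\mathcal{M}\},$$ $$J_2=\{[fX,Y\circ Z]_{\mathrm{Lei}}-[X,Y]_{\mathrm{Lei}}\circ fZ-(fY)\circ[X,Z]_{\mathrm{Lei}}: f\in\mathcal{A},\ X,Y,Z\in\mathrm{F}\mathcal{M}\},$$ and let $(J_1+J_2):=\langle J_1\rangle+\langle J_2\rangle$ be the sum of the $\mathcal{A}$-submodules of $\mathrm{F}\mathcal{M}$ generated by $J_1$ and $J_2$. Then the quotient $\mathrm{FS}\mathcal{M}:=\mathrm{F}\mathcal{M}/(J_1+J_2)$, with the induced bracket, the induced anchor, and the induced map $\tilde\imath:\mathcal{M}\to\mathrm{FS}\mathcal{M}$, $m\mapsto\tilde m$ (the class of $m$), is the free symmetric Leibniz pseudoalgebra over the anchored module $\mathcal{M}$.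
   Context: $\mathrm{Der}\,\mathcal{A}$ is the $\mathcal{A}$-module of ($R$-linear) derivations of $\mathcal{A}$, with the commutator bracket. An anchored module over $\mathcal{A}$ is an $\mathcal{A}$-module $\mathcal{E}$ with an $\mathcal{A}$-linear map $a:\mathcal{E}\to\mathrm{Der}\,\mathcal{A}$; a morphism of anchored modules $(\mathcal{E}_1,a_1)\to(\mathcal{E}_2,a_2)$ is an $\mathcal{A}$-linear map $\phi$ with $a_2\phi=a_1$. A (left) Leibniz bracket on an $R$-module is an $R$-bilinear bracket with $[X,[Y,Z]]=[[X,Y],Z]+[Y,[X,Z]]$; it makes the $R$-module a Leibniz $R$-algebra. The symmetrized bracket is $X\circ Y:=[X,Y]+[Y,X]$. A Leibniz pseudoalgebra over $(R,\mathcal{A})$ is an anchored module $(\mathcal{E},a)$ over $\mathcal{A}$ with a Leibniz $R$-algebra structure $[-,-]$ such that, for all $f\in\mathcal{A}$, $X,Y\in\mathcal{E}$: $[X,fY]=f[X,Y]+a(X)(f)Y$ and $a[X,Y]=[a(X),a(Y)]$. A morphism of Leibniz pseudoalgebras $(\mathcal{E}_1,[-,-]_1,a_1)\to(\mathcal{E}_2,[-,-]_2,a_2)$ over $(R,\mathcal{A})$ is an $\mathcal{A}$-linear map $\phi$ with $a_2\phi=a_1$ and $\phi[X,Y]_1=[\phi X,\phi Y]_2$. A Leibniz pseudoalgebra is symmetric if, for all $f\in\mathcal{A}$, $X,Y,Z\in\mathcal{E}$: $X\circ fY-(fX)\circ Y=0$ and $[fX,Y\circ Z]-[X,Y]\circ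 fZ-(fY)\circ[X,Z]=0$. Symmetric Leibniz pseudoalgebras form a full subcategory of Leibniz pseudoalgebras. A free (symmetric) Leibniz pseudoalgebra on an anchored module $\mathcal{M}$ is a (symmetric) Leibniz pseudoalgebra $\mathcal{F}$ over $(R,\mathcal{A})$ together with an anchored module morphism $i:\mathcal{M}\to \mathcal{F}$ such that, for any (symmetric) Leibniz pseudoalgebra $\mathcal{E}$ over $(R,\mathcal{A})$ and any anchored module morphism $\phi:\mathcal{M}\to\mathcal{E}$, there is a unique Leibniz pseudoalgebra morphism $\Phi:\mathcal{F}\to\mathcal{E}$ with $\Phi\, i=\phi$. The free Leibniz pseudoalgebra $\mathrm{F}\mathcal{M}$ on $(\mathcal{M},a)$ is realized as follows. Its underlying $R$-module is $\overline{T}\mathcal{M}=\bigoplus_{k\ge1}\mathcal{M}^{\otimes_R k}$, with the $\mathcal{A}$-module structure extending that of $\mathcal{M}$ and defined inductively by $f(m_1\otimes\cdots\otimes m_n):=m_1\otimes f(m_2\otimes\cdots\otimes m_n)-a(m_1)(f)(m_2\otimes\cdots\otimes m_n)$ for $n\ge2$. The bracket $[-,-]_{\mathrm{Lei}}$ is the universal Leibniz bracket, i.e. the Leibniz bracket determined by $m_1\otimes\cdots\otimes m_k=[m_1,[m_2,\ldots,[m_{k-1},m_k]\ldots]]$ for $m_i\in\mathcal{M}$. The anchor $\mathrm{F}a:\overline{T}\mathcal{M}\to\mathrm{Der}\,\mathcal{A}$ is the unique Leibniz $R$-algebra morphism extending $a$. The structure map is the inclusion $\mathcal{M}\hookrightarrow\overline{T}\mathcal{M}$.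 *)

(* Defs.v *)
From HB Require Import structures.
From mathcomp Require Import all_boot all_algebra.
From mathcomp Require Import boolp classical_sets functions.

Set Implicit Arguments.
Unset Strict Implicit.
Unset Printing Implicit Defensive.

Import GRing.Theory.
Local Open Scope ring_scope.
Local Open Scope quotient_scope.

(* A commutative R-algebra A is given by its structure morphism               *)
(* iota : {rmorphism R -> A} between commutative rings: comAlgType would      *)
(* exclude the zero algebra.  An A-module is an R-module through iota.        *)

Definition restrict (R A : comPzRingType) (iota : {rmorphism R -> A})
  (V : lmodType A) : Type := V.

Section ScalarRestriction.
Context (R A : comPzRingType) (iota : {rmorphism R -> A}) (V : lmodType A).

Local Notation restrict := (restrict iota V).
HB.instance Definition _ := GRing.Zmodule.on restrict.

Definition restrict_scale (r : R) (v : restrict) : restrict :=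
  iota r *: (v : V).

Lemma restrict_scaleA r s v :
  restrict_scale r (restrict_scale s v) = restrict_scale (r * s) v.
Proof. by rewrite /restrict_scale rmorphM scalerA. Qed.

Lemma restrict_scale1 : left_id 1 restrict_scale.
Proof. by move=> v; rewrite /restrict_scale rmorph1 scale1r. Qed.

Lemma restrict_scaleDr : right_distributive restrict_scale +%R.
Proof. by move=> r u v; rewrite /restrict_scale scalerDr. Qed.

Lemma restrict_scaleDl v : {morph restrict_scale^~ v : r s / r + s}.
Proof. by move=> r s; rewrite /restrict_scale rmorphD scalerDl. Qed.

HB.instance Definition _ := GRing.Zmodule_isLmodule.Build R restrict
  restrict_scaleA restrict_scale1 restrict_scaleDr restrict_scaleDl.

Lemma restrictE (r : R) (v : restrict) : r *: v = iota r *: (v : V) :> V.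
Proof. by []. Qed.

End ScalarRestriction.

Section Derivations.
Context (R A : comPzRingType) (iota : {rmorphism R -> A}).

Definition derivation (d : A -> A) : Prop :=
  (forall r f g, d (iota r * f + g) = iota r * d f + d g) /\
  (forall f g, d (f * g) = d f * g + f * d g).

(* A^o is A as a module over itself, so that A -> A^o is an A-module.         *)
Definition is_der : {pred (A -> A^o)} := fun d => `[< derivation d >].

Lemma is_derP d : reflect (derivation d) (d \in is_der).
Proof. exact: asboolP. Qed.

Lemma is_der_submod : GRing.subsemimod_closed is_der.
Proof.
split; first split.
- by apply/is_derP; split=> [r f g|f g];
  rewrite /GRing.zero /= !(mulr0, mul0r, addr0).
- move=> d e /is_derP[dl dm] /is_derP[el em]; apply/is_derP.
  rewrite addrfctE; split=> [r f g|f g].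
    by rewrite dl el mulrDr addrACA.
  by rewrite dm em mulrDl mulrDr addrACA.
move=> a d /is_derP[dl dm]; apply/is_derP; rewrite scalrfctE.
split=> [r f g|f g]; rewrite /GRing.scale /=.
  by rewrite dl mulrDr mulrCA.
by rewrite dm mulrDr mulrA; congr (_ + _); rewrite mulrCA.
Qed.

HB.instance Definition _ :=
  GRing.isSubSemiModClosed.Build A (A -> A^o) is_der is_der_submod.

Record Der := MkDer { der_val :> A -> A^o; der_valP : der_val \in is_der }.

HB.instance Definition _ := [isSub for der_val].
HB.instance Definition _ := [Choice of Der by <:].
HB.instance Definition _ := [SubChoice_isSubLmodule of Der by <:].
End Derivations.

Section DerivationBracket.
Context (R A : comPzRingType) (iota : {rmorphism R -> A}).
Implicit Types d e : Der iota.

Lemma der_lin d r f g : d (iota r * f + g) = iota r * d f + d g :> A.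
Proof. by have /is_derP[dl _] := der_valP d; exact: dl. Qed.

Lemma derM d f g : d (f * g) = d f * g + f * d g :> A.
Proof. by have /is_derP[_ dm] := der_valP d; exact: dm. Qed.

Lemma derD d f g : d (f + g) = d f + d g :> A.
Proof. by have := der_lin d 1 f g; rewrite rmorph1 !mul1r. Qed.

Lemma der_commP d e :
  (fun f => d (e f) - e (d f)) \in is_der iota.
Proof.
apply/is_derP; split=> [r f g|f g].
  by rewrite !der_lin mulrBr opprD addrACA.
have E (x1 x2 y z u v : A) :
    (x1 + y) + (z + u) - ((x2 + z) + (y + v)) = (x1 - x2) + (u - v).
  rewrite [z + u]addrC addrACA [y + v]addrC [x2 + z + _]addrACA [z + y]addrC.
  by rewrite opprD [LHS]addrACA subrr addr0 opprD addrACA.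
by rewrite !derM !derD !derM mulrBl mulrBr E.
Qed.

Definition der_comm d e : Der iota := MkDer (der_commP d e).

Lemma der_ext d e : (forall f, d f = e f :> A) -> d = e.
Proof. by move=> de; apply/val_inj/funext. Qed.

Lemma der_comm_linl r d1 d2 e :
  der_comm (iota r *: d1 + d2) e = iota r *: der_comm d1 e + der_comm d2 e.
Proof.
apply: der_ext => f.
change (iota r * d1 (e f) + d2 (e f) - e (iota r * d1 f + d2 f) =
        iota r * (d1 (e f) - e (d1 f)) + (d2 (e f) - e (d2 f)) :> A).
by rewrite der_lin opprD addrACA mulrBr.
Qed.

Lemma der_comm_linr r d e1 e2 :
  der_comm d (iota r *: e1 + e2) = iota r *: der_comm d e1 + der_comm d e2.
Proof.
apply: der_ext => f.
change (d (iota r * e1 f + e2 f) - (iota r * e1 (d f) + e2 (d f)) =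
        iota r * (d (e1 f) - e1 (d f)) + (d (e2 f) - e2 (d f)) :> A).
by rewrite der_lin opprD addrACA mulrBr.
Qed.

End DerivationBracket.

Section TensorModule.
Context (R : comPzRingType) (V : lmodType R).

(* The direct sum of the tensor powers V^⊗k over R, for k >= 1: the R-module  *)
(* generated by the nonempty words TWord m1 [:: m2; ...; mk], standing for    *)
(* m1 ⊗ ... ⊗ mk, subject only to R-linearity in each letter.  It splits by   *)
(* word length; tlift and tensors_ind give its universal property.            *)
Inductive texpr : Type :=
| TWord of V & seq V
| TZero
| TOpp of texpr
| TAdd of texpr & texpr
| TScale of R & texpr.

Inductive teqv : texpr -> texpr -> Prop :=
| teqv_refl x : teqv x x
| teqv_sym x y : teqv x y -> teqv y x
| teqv_trans x y z : teqv x y -> teqv y z -> teqv x z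
| teqv_opp x x' : teqv x x' -> teqv (TOpp x) (TOpp x')
| teqv_add x x' y y' :
    teqv x x' -> teqv y y' -> teqv (TAdd x y) (TAdd x' y')
| teqv_scale r x x' : teqv x x' -> teqv (TScale r x) (TScale r x')
| teqv_addA x y z : teqv (TAdd x (TAdd y z)) (TAdd (TAdd x y) z)
| teqv_addC x y : teqv (TAdd x y) (TAdd y x)
| teqv_add0 x : teqv (TAdd TZero x) x
| teqv_addN x : teqv (TAdd (TOpp x) x) TZero
| teqv_scaleA r s x : teqv (TScale r (TScale s x)) (TScale (r * s) x)
| teqv_scale1 x : teqv (TScale 1 x) x
| teqv_scaleDr r x y :
    teqv (TScale r (TAdd x y)) (TAdd (TScale r x) (TScale r y))
| teqv_scaleDl r s x :
    teqv (TScale (r + s) x) (TAdd (TScale r x) (TScale s x))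
| teqv_head r u v w :
    teqv (TWord (r *: u + v) w) (TAdd (TScale r (TWord u w)) (TWord v w))
| teqv_tail m w1 r u v w2 :
    teqv (TWord m (w1 ++ (r *: u + v) :: w2))
         (TAdd (TScale r (TWord m (w1 ++ u :: w2))) (TWord m (w1 ++ v :: w2))).

HB.instance Definition _ := gen_eqMixin texpr.
HB.instance Definition _ := gen_choiceMixin texpr.

Definition teqvb : rel texpr := fun x y => `[< teqv x y >].

Lemma teqvb_refl : reflexive teqvb.
Proof. by move=> x; apply/asboolP; exact: teqv_refl. Qed.

Lemma teqvb_sym : symmetric teqvb.
Proof. by move=> x y; apply: asbool_equiv_eq; split; exact: teqv_sym. Qed.

Lemma teqvb_trans : transitive teqvb.
Proof.
by move=> y x z /asboolP xy /asboolP yz; apply/asboolP; apply: teqv_trans xy yz.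
Qed.

Canonical teqvb_equiv := EquivRel teqvb teqvb_refl teqvb_sym teqvb_trans.

Definition tensors : Type := {eq_quot teqvb}.
HB.instance Definition _ := Choice.on tensors.
HB.instance Definition _ := EqQuotient.on tensors.

Lemma tensors_eqP x y : \pi_tensors x = \pi_tensors y <-> teqv x y.
Proof.
split=> [/eqmodP/asboolP //|xy].
by apply/eqmodP/asboolP.
Qed.

Lemma tensors_reprP x : teqv (repr (\pi_tensors x)) x.
Proof. by apply/tensors_eqP; rewrite reprK. Qed.

Definition tensors_zero : tensors := \pi_tensors TZero.
Definition tensors_opp (x : tensors) : tensors := \pi_tensors (TOpp (repr x)).
Definition tensors_add (x y : tensors) : tensors :=
  \pi_tensors (TAdd (repr x) (repr y)).
Definition tensors_scale r (x : tensors) : tensors :=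
  \pi_tensors (TScale r (repr x)).

Lemma tensors_oppE x : tensors_opp (\pi_tensors x) = \pi_tensors (TOpp x).
Proof. by apply/tensors_eqP; apply/teqv_opp/tensors_reprP. Qed.

Lemma tensors_addE x y :
  tensors_add (\pi_tensors x) (\pi_tensors y) = \pi_tensors (TAdd x y).
Proof. by apply/tensors_eqP; apply: teqv_add; apply/tensors_reprP. Qed.

Lemma tensors_scaleE r x :
  tensors_scale r (\pi_tensors x) = \pi_tensors (TScale r x).
Proof. by apply/tensors_eqP; apply/teqv_scale/tensors_reprP. Qed.

Lemma tensors_addA : associative tensors_add.
Proof.
elim/quotW=> x; elim/quotW=> y; elim/quotW=> z; 
rewrite (tensors_addE y) (tensors_addE x y) !tensors_addE.
exact/tensors_eqP/teqv_addA.
Qed.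

Lemma tensors_addC : commutative tensors_add.
Proof.
elim/quotW=> x; elim/quotW=> y; rewrite !tensors_addE.
exact/tensors_eqP/teqv_addC.
Qed.

Lemma tensors_add0 : left_id tensors_zero tensors_add.
Proof.
by elim/quotW=> x; rewrite tensors_addE; exact/tensors_eqP/teqv_add0.
Qed.

Lemma tensors_addN : left_inverse tensors_zero tensors_opp tensors_add.
Proof.
elim/quotW=> x; rewrite tensors_oppE tensors_addE.
exact/tensors_eqP/teqv_addN.
Qed.

HB.instance Definition _ := GRing.isZmodule.Build tensors
  tensors_addA tensors_addC tensors_add0 tensors_addN.

Lemma tensors_scaleA r s x :
  tensors_scale r (tensors_scale s x) = tensors_scale (r * s) x.
Proof.
elim/quotW: x => x; rewrite (tensors_scaleE s) !tensors_scaleE.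
exact/tensors_eqP/teqv_scaleA.
Qed.

Lemma tensors_scale1 : left_id 1 tensors_scale.
Proof.
by elim/quotW=> x; rewrite tensors_scaleE; exact/tensors_eqP/teqv_scale1.
Qed.

Lemma tensors_scaleDr : right_distributive tensors_scale +%R.
Proof.
move=> r; elim/quotW=> x; elim/quotW=> y.

rewrite /GRing.add /= (tensors_addE x) !tensors_scaleE tensors_addE.
exact/tensors_eqP/teqv_scaleDr.
Qed.

Lemma tensors_scaleDl x : {morph tensors_scale^~ x : r s / r + s}.
Proof.
move=> r s; elim/quotW: x => x.
rewrite [RHS]/GRing.add /= !tensors_scaleE tensors_addE.
exact/tensors_eqP/teqv_scaleDl.
Qed.

HB.instance Definition _ := GRing.Zmodule_isLmodule.Build R tensors
  tensors_scaleA tensors_scale1 tensors_scaleDr tensors_scaleDl.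

Definition word (m : V) (w : seq V) : tensors := \pi_tensors (TWord m w).

Definition multilinear (W : lmodType R) (h : V -> seq V -> W) : Prop :=
  (forall r u v w, h (r *: u + v) w = r *: h u w + h v w) /\
  (forall m w1 r u v w2,
     h m (w1 ++ (r *: u + v) :: w2) =
     r *: h m (w1 ++ u :: w2) + h m (w1 ++ v :: w2)).

Lemma word_multilinear : multilinear word.
Proof.
split=> *; rewrite [RHS]/GRing.add [in RHS]/GRing.scale /=;
  rewrite tensors_scaleE tensors_addE; apply/tensors_eqP.
- exact: teqv_head.
- exact: teqv_tail.
Qed.

Lemma tensors_ind (P : tensors -> Prop) :
    (forall m w, P (word m w)) ->
    (forall r x y, P x -> P y -> P (r *: x + y)) ->
  forall x, P x.
Proof.
move=> Pw Plin; have P0 : P 0.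
  have := Plin (-1) (word 0 [::]) (word 0 [::]) (Pw _ _) (Pw _ _).
  by rewrite scaleN1r addNr.
have PZ r x : P x -> P (r *: x).
  by move=> Px; rewrite -[_ *: _]addr0; apply: Plin.
have PD x y : P x -> P y -> P (x + y).
  by move=> Px Py; rewrite -[x]scale1r; apply: Plin.
elim/quotW; elim=> [m w||x Px|x Px y Py|r x Px].
- exact: Pw.
- exact: P0.
- have -> : \pi_tensors (TOpp x) = - \pi_tensors x.
    by rewrite /GRing.opp /= tensors_oppE.
  by rewrite -scaleN1r; apply: PZ.
- have -> : \pi_tensors (TAdd x y) = \pi_tensors x + \pi_tensors y.
    by rewrite /GRing.add /= tensors_addE.
  exact: PD.
- have -> : \pi_tensors (TScale r x) = r *: \pi_tensors x.
    by rewrite /GRing.scale /= tensors_scaleE.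
  exact: PZ.
Qed.

Section Lift.
Context (W : lmodType R) (h : V -> seq V -> W).

Fixpoint teval (x : texpr) : W :=
  match x with
  | TWord m w => h m w
  | TZero => 0
  | TOpp x => - teval x
  | TAdd x y => teval x + teval y
  | TScale r x => r *: teval x
  end.

Definition tlift (x : tensors) : W := teval (repr x).

Hypothesis hM : multilinear h.

Lemma teval_eqv x y : teqv x y -> teval x = teval y.
Proof.
elim=> //= {x y}.
- by move=> x y z _ -> _ ->.
- by move=> x y _ ->.
- by move=> x x' y y' _ -> _ ->.
- by move=> r x x' _ ->.
- by move=> x y z; rewrite addrA.
- by move=> x y; rewrite addrC.
- by move=> x; rewrite add0r.
- by move=> x; rewrite addNr.
- by move=> r s x; rewrite scalerA.
- by move=> x; rewrite scale1r.
- by move=> r x y; rewrite scalerDr.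
- by move=> r s x; rewrite scalerDl.
- by case: hM.
- by case: hM.
Qed.

Lemma tlift_pi x : tlift (\pi_tensors x) = teval x.
Proof. exact/teval_eqv/tensors_reprP. Qed.

Lemma tlift_word m w : tlift (word m w) = h m w.
Proof. by rewrite tlift_pi. Qed.

Lemma tlift_linear : linear tlift.
Proof.
move=> r; elim/quotW=> x; elim/quotW=> y.
rewrite /GRing.scale /= tensors_scaleE /GRing.add /= tensors_addE.
by rewrite !tlift_pi.
Qed.

End Lift.

(* tens m x is m ⊗ x.                                                         *)
Definition tens (m : V) : tensors -> tensors :=
  tlift (fun m' w => word m (m' :: w)).

Lemma tens_multilinear m : multilinear (fun m' w => word m (m' :: w)).
Proof.
split=> [r u v w|m' w1 r u v w2]; rewrite ?(proj2 word_multilinear m [::]) //.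
exact: (proj2 word_multilinear m (m' :: w1)).
Qed.

Lemma tens_word m m' w : tens m (word m' w) = word m (m' :: w).
Proof. exact: tlift_word (tens_multilinear m) _ _. Qed.

Lemma tens_linear m : linear (tens m).
Proof. exact: tlift_linear (tens_multilinear m). Qed.

Lemma tensP m r x y : tens m (r *: x + y) = r *: tens m x + tens m y.
Proof. exact: tens_linear. Qed.

Lemma tens_linearl r u v x : tens (r *: u + v) x = r *: tens u x + tens v x.
Proof.
elim/tensors_ind: x => [m w|s x y IHx IHy].
  by rewrite !tens_word (proj1 word_multilinear).
rewrite !tensP IHx IHy !scalerDr !scalerA mulrC.
by rewrite addrACA.
Qed.

Lemma tensors_rec (P : tensors -> Prop) :
    (forall m, P (word m [::])) ->
    (forall m x, P x -> P (tens m x)) ->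
    (forall r x y, P x -> P y -> P (r *: x + y)) ->
  forall x, P x.
Proof.
move=> P1 Pt Pl; apply: tensors_ind => // m w.
by elim: w m => [|m' w IHw] m //; rewrite -tens_word; apply: Pt.
Qed.

End TensorModule.

Record anchoredModule (R A : comPzRingType) (iota : {rmorphism R -> A}) :=
  AnchoredModule {
    am_sort :> lmodType A;
    am_anchor : {linear am_sort -> Der iota}
  }.

Section FreeLeibniz.
Context (R A : comPzRingType) (iota : {rmorphism R -> A}).
Context (M : anchoredModule iota).

Local Notation a := (@am_anchor R A iota M).
Local Notation MR := (restrict iota M).
Local Notation T := (tensors MR).

(* f (m1 ⊗ x) = m1 ⊗ f x - a(m1)(f) x; see act_tens.                          *)
Fixpoint act_word (f : A) (m : MR) (w : seq MR) : T :=
  match w with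
  | [::] => word (f *: (m : M) : MR) [::]
  | m' :: w' => tens m (act_word f m' w') - act_word (a m f) m' w'
  end.

Definition act (f : A) : T -> T := tlift (act_word f).

Lemma anchorP r (u v : MR) (f : A) :
  a (r *: u + v) f = iota r * a u f + a v f :> A.
Proof. by rewrite (linearP a (iota r) u v). Qed.

Lemma act_word_lin r f g m w :
  act_word (iota r * f + g) m w = r *: act_word f m w + act_word g m w.
Proof.
elim: w m f g => [|m' w IHw] m f g /=.
  rewrite -(proj1 (@word_multilinear _ MR)).
  by congr word; rewrite restrictE scalerDl scalerA.
rewrite der_lin !IHw tensP scalerBr !opprD addrACA.
by [].
Qed.

Lemma act_word_multilinear f : multilinear (act_word f).
Proof.
have H g r u v w :
    act_word g (r *: u + v) w = r *: act_word g u w + act_word g v w.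
  case: w => [|m w] /=.
    rewrite -(proj1 (@word_multilinear _ MR)); congr word.
    by rewrite !restrictE scalerDr !scalerA mulrC.
  by rewrite tens_linearl anchorP act_word_lin scalerBr opprD addrACA.
split=> [r u v w|m w1 r u v w2]; first exact: H.
elim: w1 m f => [|m' w1 IHw1] m f /=.
  by rewrite !H tensP scalerBr opprD addrACA.
by rewrite !IHw1 tensP scalerBr opprD addrACA.
Qed.

Lemma actP f r x y : act f (r *: x + y) = r *: act f x + act f y.
Proof. exact: (tlift_linear (act_word_multilinear f)). Qed.

Lemma actE f m w : act f (word m w) = act_word f m w.
Proof. exact: tlift_word (act_word_multilinear f) _ _. Qed.

Lemma act_gen f (m : MR) : act f (word m [::]) = word (f *: (m : M) : MR) [::].
Proof. by rewrite actE. Qed.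

Lemma act_lin r f g x : act (iota r * f + g) x = r *: act f x + act g x.
Proof.
elim/tensors_ind: x => [m w|s x y IHx IHy].
  by rewrite !actE act_word_lin.
by rewrite !actP IHx IHy !scalerDr !scalerA mulrC addrACA.
Qed.

Lemma act_tens f m x : act f (tens m x) = tens m (act f x) - act (a m f) x.
Proof.
elim/tensors_ind: x => [m' w|r x y IHx IHy].
  by rewrite tens_word !actE.
by rewrite tensP !actP IHx IHy tensP scalerBr opprD addrACA.
Qed.

Lemma actD f g x : act (f + g) x = act f x + act g x.
Proof. by have := act_lin 1 f g x; rewrite rmorph1 mul1r scale1r. Qed.

Lemma act0 x : act 0 x = 0.
Proof. by apply: (addrI (act 0 x)); rewrite -actD !addr0. Qed.

Lemma der1 (d : Der iota) : d 1 = 0 :> A.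
Proof.
by apply: (addrI (d 1 : A)); rewrite addr0 -{3}[1 : A]mulr1 derM mulr1 mul1r.
Qed.

Lemma act1 x : act 1 x = x.
Proof.
elim/tensors_rec: x => [m|m x IHx|r x y IHx IHy].
- by rewrite act_gen scale1r.
- by rewrite act_tens IHx der1 act0 subr0.
- by rewrite actP IHx IHy.
Qed.

Lemma actM f g x : act f (act g x) = act (f * g) x.
Proof.
elim/tensors_rec: x f g => [m|m x IHx|r x y IHx IHy] f g.
- by rewrite !act_gen scalerA.
- have actB h y z : act h (y - z) = act h y - act h z.
    by rewrite -scaleN1r addrC actP scaleN1r addrC.
  by rewrite !act_tens actB act_tens !IHx derM actD opprD addrAC -!addrA
    [- _ - _]addrC.
- by rewrite !actP IHx IHy.
Qed.

(* freeLeib has the same elements as T, but A acts through act; the two       *)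
(* R-module structures agree by act_iota.                                     *)
Definition freeLeib : Type := T.
HB.instance Definition _ := GRing.Zmodule.on freeLeib.

Lemma act_Dr : right_distributive (act : A -> freeLeib -> freeLeib) +%R.
Proof. by move=> f x y; have := actP f 1 x y; rewrite !scale1r. Qed.

HB.instance Definition _ := GRing.Zmodule_isLmodule.Build A freeLeib
  actM act1 act_Dr (fun x f g => actD f g x).

Definition freeLeib_gen (m : M) : freeLeib := word (m : MR) [::].

(* [m, y] = m ⊗ y, hence [m ⊗ x, y] = [[m, x], y] = [m, [x, y]] - [x, [m, y]] *)
(* by the Leibniz identity, which br_leibniz proves in general.               *)
Fixpoint bracket_word (y : T) (m : MR) (w : seq MR) : T :=
  match w with
  | [::] => tens m y
  | m' :: w' => tens m (bracket_word y m' w') - bracket_word (tens m y) m' w'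
  end.

Definition freeLeib_bracket (x y : freeLeib) : freeLeib :=
  tlift (bracket_word y) x.

Lemma bracket_word_lin y r u v w :
  bracket_word y (r *: u + v) w = r *: bracket_word y u w + bracket_word y v w.
Proof.
case: w => [|m w] /=; first by rewrite tens_linearl.
rewrite !tens_linearl.
have H : forall z1 z2 m' w', bracket_word (r *: z1 + z2) m' w' =
    r *: bracket_word z1 m' w' + bracket_word z2 m' w'.
  move=> z1 z2 m' w'; elim: w' m' z1 z2 => [|m2 w2 IHw] m' z1 z2 /=.
    by rewrite tensP.
  by rewrite IHw !tensP IHw scalerBr opprD addrACA.
by rewrite H scalerBr opprD addrACA.
Qed.

Lemma bracket_word_multilinear y : multilinear (bracket_word y).
Proof.
split=> [*|m w1]; first exact: bracket_word_lin.
elim: w1 m y => [|m' w1 IHw1] m y r u v w2 /=.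
  by rewrite !bracket_word_lin tensP scalerBr opprD addrACA.
by rewrite !IHw1 tensP scalerBr opprD addrACA.
Qed.

Lemma freeLeib_bracketPl r (x x' y : T) :
  freeLeib_bracket (r *: x + x') y =
  r *: (freeLeib_bracket x y : T) + (freeLeib_bracket x' y : T).
Proof. exact: (tlift_linear (bracket_word_multilinear y)). Qed.

Lemma freeLeib_bracket_gen (m : MR) y :
  freeLeib_bracket (word m [::]) y = tens m y.
Proof. exact: tlift_word (bracket_word_multilinear y) _ _. Qed.

Lemma freeLeib_bracket_tens (m : MR) x y :
  freeLeib_bracket (tens m x) y =
  tens m (freeLeib_bracket x y) - freeLeib_bracket x (tens m y).
Proof.
elim/tensors_ind: x => [m' w|r x x' IHx IHx'].
  rewrite tens_word /freeLeib_bracket.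
  by rewrite !(tlift_word (bracket_word_multilinear _)).
by rewrite tensP !freeLeib_bracketPl IHx IHx' tensP scalerBr opprD addrACA.
Qed.

Fixpoint anchor_word (m : MR) (w : seq MR) : restrict iota (Der iota) :=
  match w with
  | [::] => a m
  | m' :: w' => der_comm (a m) (anchor_word m' w')
  end.

Definition freeLeib_anchor (x : freeLeib) : Der iota := tlift anchor_word x.

Lemma anchor_word_multilinear : multilinear anchor_word.
Proof.
have H r u v w :
    anchor_word (r *: u + v) w = r *: anchor_word u w + anchor_word v w.
  by case: w => [|m w] /=; rewrite (linearP a (iota r) u v) ?der_comm_linl.
split=> [|m w1]; first exact: H.
elim: w1 m => [|m' w1 IHw1] m r u v w2 /=.
  by rewrite H der_comm_linr.
by rewrite IHw1 der_comm_linr.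
Qed.

Lemma freeLeib_anchor_gen (m : M) : freeLeib_anchor (freeLeib_gen m) = a m.
Proof. exact: tlift_word anchor_word_multilinear _ _. Qed.

Lemma freeLeib_anchorP r (x y : T) :
  freeLeib_anchor (r *: x + y) =
  iota r *: freeLeib_anchor x + freeLeib_anchor y.
Proof. exact: (tlift_linear anchor_word_multilinear). Qed.

Lemma freeLeib_anchor_tens (m : MR) x :
  freeLeib_anchor (tens m x) = der_comm (a m) (freeLeib_anchor x).
Proof.
elim/tensors_ind: x => [m' w|r x y IHx IHy].
  by rewrite tens_word /freeLeib_anchor !(tlift_word anchor_word_multilinear).
by rewrite tensP !freeLeib_anchorP IHx IHy der_comm_linr.
Qed.

End FreeLeibniz.

Section LeibnizPseudoalgebras.
Context (R A : comPzRingType) (iota : {rmorphism R -> A}).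

(* The data of a Leibniz pseudoalgebra, without its axioms.                   *)
Record preLeibniz := PreLeibniz {
  pl_sort :> lmodType A;
  pl_bracket : pl_sort -> pl_sort -> pl_sort;
  pl_anchor : pl_sort -> Der iota
}.

Definition leibniz_bracket (E : lmodType A) (br : E -> E -> E) : Prop :=
  [/\ forall r X Y Z, br (iota r *: X + Y) Z = iota r *: br X Z + br Y Z,
      forall r X Y Z, br X (iota r *: Y + Z) = iota r *: br X Y + br X Z
    & forall X Y Z, br X (br Y Z) = br (br X Y) Z + br Y (br X Z)].

Definition leibniz_pseudoalgebra (E : preLeibniz) : Prop :=
  [/\ linear (@pl_anchor E),
      leibniz_bracket (@pl_bracket E),
      forall (f : A) (X Y : E),
        pl_bracket X (f *: Y) = f *: pl_bracket X Y + pl_anchor X f *: Y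
    & forall X Y : E,
        pl_anchor (pl_bracket X Y) = der_comm (pl_anchor X) (pl_anchor Y)].

Definition circ (E : preLeibniz) (X Y : E) : E :=
  pl_bracket X Y + pl_bracket Y X.

Definition sym_defect1 (E : preLeibniz) (f : A) (X Y : E) : E :=
  circ X (f *: Y) - circ (f *: X) Y.

Definition sym_defect2 (E : preLeibniz) (f : A) (X Y Z : E) : E :=
  pl_bracket (f *: X) (circ Y Z) - circ (pl_bracket X Y) (f *: Z)
  - circ (f *: Y) (pl_bracket X Z).

Definition symmetric_leibniz (E : preLeibniz) : Prop :=
  (forall (f : A) (X Y : E), sym_defect1 f X Y = 0) /\
  (forall (f : A) (X Y Z : E), sym_defect2 f X Y Z = 0).

Definition anchored_morphism (E1 E2 : lmodType A) (a1 : E1 -> Der iota)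
    (a2 : E2 -> Der iota) (phi : E1 -> E2) : Prop :=
  linear phi /\ (forall X, a2 (phi X) = a1 X).

Definition leibniz_morphism (E1 E2 : preLeibniz) (phi : E1 -> E2) : Prop :=
  anchored_morphism (@pl_anchor E1) (@pl_anchor E2) phi /\
  (forall X Y, phi (pl_bracket X Y) = pl_bracket (phi X) (phi Y)).

(* The free object on M, for the full subcategory of those Leibniz            *)
(* pseudoalgebras that satisfy P.                                             *)
Definition free_in (P : preLeibniz -> Prop) (M : anchoredModule iota)
    (F : preLeibniz) (i : M -> F) : Prop :=
  [/\ leibniz_pseudoalgebra F, P F,
      anchored_morphism (am_anchor M) (@pl_anchor F) i
    & forall E : preLeibniz, leibniz_pseudoalgebra E -> P E ->
      forall phi : M -> E,
        anchored_morphism (am_anchor M) (@pl_anchor E) phi ->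
      exists! Phi : F -> E, leibniz_morphism Phi /\ Phi \o i = phi].

Definition free_leibniz (M : anchoredModule iota) (F : preLeibniz)
  (i : M -> F) : Prop := free_in (fun=> True) i.

Definition free_symmetric_leibniz (M : anchoredModule iota) (F : preLeibniz)
  (i : M -> F) : Prop := free_in symmetric_leibniz i.

End LeibnizPseudoalgebras.

Section Submodules.
Context (A : comPzRingType) (V : lmodType A).
Local Open Scope classical_set_scope.

Definition submodule (N : set V) : Prop :=
  N 0 /\ (forall f x y, N x -> N y -> N (f *: x + y)).

Definition submodule_gen (S : set V) : set V := smallest submodule S.

Definition submodule_add (N1 N2 : set V) : set V :=
  [set z | exists2 x, N1 x & exists2 y, N2 y & z = x + y].

Lemma submodule_genP S : submodule (submodule_gen S).
Proof.
split=> [N [[]]|f x y Sx Sy N [Nm SN]] //.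
by apply: Nm.2; [apply: Sx | apply: Sy].
Qed.

Lemma submodule_addP N1 N2 :
  submodule N1 -> submodule N2 -> submodule (submodule_add N1 N2).
Proof.
move=> [N10 N1l] [N20 N2l]; split.
  by exists 0 => //; exists 0; rewrite ?addr0.
move=> f _ _ [x1 x1N [y1 y1N ->]] [x2 x2N [y2 y2N ->]].
exists (f *: x1 + x2); first exact: N1l.
exists (f *: y1 + y2); first exact: N2l.
by rewrite scalerDr addrACA.
Qed.

End Submodules.

Section FreeSymmetricLeibniz.
Context (R A : comPzRingType) (iota : {rmorphism R -> A}).
Context (M : anchoredModule iota).

Definition FL : preLeibniz iota :=
  PreLeibniz (@freeLeib_bracket R A iota M) (@freeLeib_anchor R A iota M).

Definition FL_incl : M -> FL := @freeLeib_gen R A iota M.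

Local Open Scope classical_set_scope.

Definition J1 : set FL :=
  [set z | exists (f : A) (X Y : FL), z = sym_defect1 f X Y].

Definition J2 : set FL :=
  [set z | exists (f : A) (X Y Z : FL), z = sym_defect2 f X Y Z].

Definition J : set FL := submodule_add (submodule_gen J1) (submodule_gen J2).

Lemma J_submodule : submodule J.
Proof. by apply: submodule_addP; apply: submodule_genP. Qed.

Definition Jpred : {pred freeLeib M} := fun x => `[< J x >].

Lemma Jpred_submod : submod_closed Jpred.
Proof.
have [J0 Jl] := J_submodule; split; first exact/asboolP.
by move=> f x y /asboolP Jx /asboolP Jy; apply/asboolP; apply: Jl.
Qed.

HB.instance Definition _ :=
  GRing.isZmodClosed.Build (freeLeib M) Jpred
    (GRing.submod_closedB Jpred_submod).

Definition FSL_sort : Type := {ideal_quot Jpred}.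
HB.instance Definition _ := GRing.Zmodule.on FSL_sort.

Definition FSL_class (x : FL) : FSL_sort := \pi_{ideal_quot Jpred} x.

Definition FSL_repr (x : FSL_sort) : FL := repr (x : {ideal_quot Jpred}).

Lemma FSL_classK : cancel FSL_repr FSL_class.
Proof. exact: reprK. Qed.

Lemma FSL_class_eqP x y : FSL_class x = FSL_class y <-> J (x - y).
Proof.
split=> [/eqP|Jxy].
  by rewrite /FSL_class -Quotient.idealrBE => /asboolP.
by apply/eqP; rewrite /FSL_class -Quotient.idealrBE; apply/asboolP.
Qed.

Lemma FSL_classD x y : FSL_class (x + y) = FSL_class x + FSL_class y.
Proof. exact: (raddfD (\pi_{ideal_quot Jpred})). Qed.

Definition FSL_scale (f : A) (x : FSL_sort) : FSL_sort :=
  FSL_class (f *: FSL_repr x).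

Lemma FSL_scaleE f x : FSL_scale f (FSL_class x) = FSL_class (f *: x).
Proof.
apply/FSL_class_eqP; rewrite -scalerBr -[_ *: _]addr0.
have [J0 Jl] := J_submodule; apply: Jl => //.
by apply/FSL_class_eqP; rewrite FSL_classK.
Qed.

Lemma FSL_scaleA f g x : FSL_scale f (FSL_scale g x) = FSL_scale (f * g) x.
Proof. by rewrite -[x]FSL_classK !FSL_scaleE scalerA. Qed.

Lemma FSL_scale1 : left_id 1 FSL_scale.
Proof. by move=> x; rewrite -[x]FSL_classK !FSL_scaleE scale1r. Qed.

Lemma FSL_scaleDr : right_distributive FSL_scale +%R.
Proof.
move=> f x y; rewrite -[x]FSL_classK -[y]FSL_classK.
by rewrite -FSL_classD !FSL_scaleE scalerDr FSL_classD.
Qed.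

Lemma FSL_scaleDl x : {morph FSL_scale^~ x : f g / f + g}.
Proof.
move=> f g; rewrite -[x]FSL_classK.
by rewrite !FSL_scaleE scalerDl FSL_classD.
Qed.

HB.instance Definition _ := GRing.Zmodule_isLmodule.Build A FSL_sort
  FSL_scaleA FSL_scale1 FSL_scaleDr FSL_scaleDl.

(* FSL_bracket and FSL_anchor use a chosen representative of each class; that *)
(* they do not depend on the choice is not established here.                  *)
Definition FSL_bracket (x y : FSL_sort) : FSL_sort :=
  FSL_class (pl_bracket (FSL_repr x) (FSL_repr y)).

Definition FSL_anchor (x : FSL_sort) : Der iota := pl_anchor (FSL_repr x).

Definition FSL : preLeibniz iota := PreLeibniz FSL_bracket FSL_anchor.

Definition FSL_incl (m : M) : FSL := FSL_class (FL_incl m).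

End FreeSymmetricLeibniz.

Section FreeLeibnizTheory.
Context (R A : comPzRingType) (iota : {rmorphism R -> A}).
Context (M : anchoredModule iota).
Local Notation MR := (restrict iota M).
Local Notation T := (tensors MR).
Local Notation br := (@freeLeib_bracket R A iota M).
Local Notation Fa := (@freeLeib_anchor R A iota M).
Local Notation a := (@am_anchor R A iota M).

Lemma act_iota r (x : T) : @act R A iota M (iota r) x = r *: x.
Proof. by have := act_lin r 1 0 x; rewrite mulr1 addr0 act0 act1 addr0. Qed.

Lemma tensD m (x y : T) : tens m (x + y) = tens m x + tens m y.
Proof. by have := tensP m 1 x y; rewrite !scale1r. Qed.

Lemma tensB m (x y : T) : tens m (x - y) = tens m x - tens m y.
Proof. by have := tensP m (-1) y x; rewrite !scaleN1r addrC [RHS]addrC. Qed.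

Lemma brPr r (x y z : T) :
  br x (r *: y + z) = r *: (br x y : T) + (br x z : T) :> T.
Proof.
elim/tensors_rec: x y z => [m|m x IHx|s x x' IHx IHx'] y z.
- by rewrite !freeLeib_bracket_gen tensP.
- by rewrite !freeLeib_bracket_tens tensP !IHx tensP scalerBr opprD addrACA.
- by rewrite !freeLeib_bracketPl IHx IHx' !scalerDr !scalerA mulrC addrACA.
Qed.

Lemma brBr (x y z : T) : br x (y - z) = (br x y : T) - (br x z : T) :> T.
Proof. by have := brPr (-1) x z y; rewrite !scaleN1r addrC [RHS]addrC. Qed.

Lemma brBl (x y z : T) : br (x - y) z = (br x z : T) - (br y z : T) :> T.
Proof.
by have := freeLeib_bracketPl (-1) y x z; rewrite !scaleN1r addrC [RHS]addrC.
Qed.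

Lemma brDr (x y z : T) : br x (y + z) = (br x y : T) + (br x z : T) :> T.
Proof. by have := brPr 1 x y z; rewrite !scale1r. Qed.

Lemma br_leibniz (x y z : T) :
  br x (br y z) = (br (br x y) z : T) + (br y (br x z) : T) :> T.
Proof.
elim/tensors_rec: x y z => [m|m x IHx|s x x' IHx IHx'] y z.
- by rewrite !freeLeib_bracket_gen freeLeib_bracket_tens subrK.
- rewrite !freeLeib_bracket_tens brBl freeLeib_bracket_tens brBr.
  have H := freeLeib_bracket_tens m y z.
  have -> : tens m (br y z) = (br (tens m y) z : T) + br y (tens m z) :> T.
    by rewrite H subrK.
  rewrite (IHx y z) tensD brDr (IHx (tens m y)) (IHx y (tens m z)).
  rewrite freeLeib_bracket_tens.
  have E (V : zmodType) (p q b c d e : V) :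
      p + q - (b + (q - c) + (d + e)) = p - d - b + (c - e).
    have -> : b + (q - c) + (d + e) = q + (d + b + (e - c)).
      by rewrite [b + _]addrCA -addrA [b - c + _]addrC addrACA.
    by rewrite opprD addrA addrK opprD opprB opprD !addrA.
  exact: E.
- by rewrite !freeLeib_bracketPl IHx IHx' brPr scalerDr addrACA.
Qed.

Lemma FaD (x y : T) : Fa (x + y) = Fa x + Fa y.
Proof. by have := freeLeib_anchorP 1 x y; rewrite rmorph1 !scale1r. Qed.

Lemma FaB (x y : T) : Fa (x - y) = Fa x - Fa y.
Proof.
have := freeLeib_anchorP (-1) y x.
by rewrite rmorphN rmorph1 !scaleN1r addrC [RHS]addrC.
Qed.

Lemma Fa_act f (x : T) : Fa (act f x) = f *: Fa x.
Proof.
elim/tensors_rec: x f => [m|m x IHx|s x x' IHx IHx'] f.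
- by rewrite act_gen freeLeib_anchor_gen linearZ /= freeLeib_anchor_gen.
- rewrite act_tens FaB !freeLeib_anchor_tens !IHx; apply: der_ext => g.
  change (a m (f * Fa x g) - f * Fa x (a m g) - a m f * Fa x g =
          f * (a m (Fa x g) - Fa x (a m g)) :> A).
  by rewrite derM mulrBr [a m f * _ + _]addrC addrAC addrK.
- by rewrite actP !freeLeib_anchorP IHx IHx' scalerDr !scalerA mulrC.
Qed.

Lemma derB (d : Der iota) f g : d (f - g) = d f - d g :> A.
Proof.
have := der_lin d (-1) g f.
by rewrite rmorphN rmorph1 !mulN1r addrC [RHS]addrC.
Qed.

Lemma Fa_br (x y : T) : Fa (br x y) = der_comm (Fa x) (Fa y).
Proof.
elim/tensors_rec: x y => [m|m x IHx|s x x' IHx IHx'] y.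
- by rewrite freeLeib_bracket_gen freeLeib_anchor_tens freeLeib_anchor_gen.
- rewrite freeLeib_bracket_tens FaB freeLeib_anchor_tens !IHx.
  rewrite !freeLeib_anchor_tens.
  apply: der_ext => g.
  change (a m (Fa x (Fa y g) - Fa y (Fa x g))
    - (Fa x (Fa y (a m g)) - Fa y (Fa x (a m g)))
    - (Fa x (a m (Fa y g) - Fa y (a m g))
       - (a m (Fa y (Fa x g)) - Fa y (a m (Fa x g))))
   = a m (Fa x (Fa y g)) - Fa x (a m (Fa y g))
   - Fa y (a m (Fa x g) - Fa x (a m g)) :> A).
  rewrite !derB.
  have E (p q r s t u : A) :
    p - q - (r - s) - (t - r - (q - u)) = p - t - (u - s).
    rewrite !opprB [LHS]addrACA !subrKA [LHS]addrACA [RHS]addrACA.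
    by rewrite [- u - t]addrC.
  exact: E.
- by rewrite freeLeib_bracketPl !freeLeib_anchorP IHx IHx' der_comm_linl.
Qed.

Lemma br_act f (x y : T) :
  br x (act f y) = act f (br x y) + (act (Fa x f : A) y : T) :> T.
Proof.
have actB h (u v : T) : act h (u - v) = act h u - act h v.
  by have := actP h (-1) v u; rewrite !scaleN1r addrC [RHS]addrC.
elim/tensors_rec: x f y => [m|m x IHx|s x x' IHx IHx'] f y.
- by rewrite !freeLeib_bracket_gen act_tens freeLeib_anchor_gen subrK.
- rewrite !freeLeib_bracket_tens freeLeib_anchor_tens IHx tensD.
  have tact g z : tens m (act g z) = act g (tens m z) + act (a m g : A) z.
    by rewrite act_tens subrK.
  rewrite !tact brDr !IHx actB.
  have -> : act (der_comm (a m) (Fa x) f : A) y =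
      act (a m (Fa x f) : A) y - act (Fa x (a m f) : A) y.
    by apply: (addIr (act (Fa x (a m f) : A) y)); rewrite -actD !subrK.
  have E (V : zmodType) (p b c d q g : V) :
      p + b + (c + d) - (q + c + (b + g)) = p - q + (d - g).
    rewrite [c + d]addrC addrACA [b + g]addrC [q + c + _]addrACA [c + b]addrC.
    by rewrite opprD [LHS]addrACA subrr addr0 opprD addrACA.
  exact: E.
- rewrite !freeLeib_bracketPl freeLeib_anchorP IHx IHx' actP.
  have -> : act ((iota s *: Fa x + Fa x') f : A) y =
      s *: act (Fa x f : A) y + act (Fa x' f : A) y by exact: act_lin.
  by rewrite scalerDr addrACA.
Qed.

Lemma FL_leibniz : leibniz_pseudoalgebra (FL M).
Proof.
split=> [f x y||f x y|x y] /=.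
- by rewrite FaD Fa_act.
- split=> [r x y z|r x y z|x y z] /=.
  + exact: (etrans (congr1 (br^~ z) (congr1 (+%R^~ y) (act_iota r x)))
      (etrans (freeLeib_bracketPl r x y z)
        (congr1 (+%R^~ (br y z)) (esym (act_iota r (br x z)))))).
  + exact: (etrans (congr1 (br x) (congr1 (+%R^~ z) (act_iota r y)))
      (etrans (brPr r x y z)
        (congr1 (+%R^~ (br x z)) (esym (act_iota r (br x y)))))).
  + exact: br_leibniz.
- exact: br_act.
- exact: Fa_br.
Qed.

Section Universal.
Context (E : preLeibniz iota) (lpaE : leibniz_pseudoalgebra E).
Context (phi : M -> E).
Hypothesis phiP : anchored_morphism (am_anchor M) (@pl_anchor _ _ _ E) phi.
Local Notation ER := (restrict iota E).

Fixpoint ext_word (m : MR) (w : seq MR) : ER :=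
  match w with
  | [::] => phi m
  | m' :: w' => pl_bracket (phi m) (ext_word m' w')
  end.

Definition ext (x : T) : ER := tlift ext_word x.

Lemma ext_word_multilinear : multilinear ext_word.
Proof.
case: phiP => phil _; case: lpaE => _ [brl brr _] _ _.
have H r u v w : ext_word (r *: u + v) w = r *: ext_word u w + ext_word v w.
  case: w => [|m w] /=; first exact: (phil (iota r) u v).
  by rewrite (phil (iota r) u v) brl.
split=> [|m w1]; first exact: H.
elim: w1 m => [|m' w1 IHw1] m r u v w2 /=.
  by rewrite H brr.
by rewrite IHw1 brr.
Qed.

Lemma extP r x y : ext (r *: x + y) = r *: ext x + ext y.
Proof. exact: (tlift_linear ext_word_multilinear). Qed.

Lemma ext_gen (m : MR) : ext (word m [::]) = phi m.
Proof. exact: tlift_word ext_word_multilinear _ _. Qed.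

Lemma ext_tens (m : MR) x : ext (tens m x) = pl_bracket (phi m) (ext x : E).
Proof.
case: lpaE => _ [_ brr _] _ _.
elim/tensors_ind: x => [m' w|r x y IHx IHy].
  by rewrite tens_word /ext !(tlift_word ext_word_multilinear).
by rewrite tensP !extP IHx IHy brr.
Qed.

Lemma extD x y : ext (x + y) = ext x + ext y.
Proof. by have := extP 1 x y; rewrite !scale1r. Qed.

Lemma extB x y : ext (x - y) = ext x - ext y.
Proof. by have := extP (-1) y x; rewrite !scaleN1r addrC [RHS]addrC. Qed.

Lemma ext_act f x : ext (act f x) = f *: (ext x : E) :> E.
Proof.
case: phiP => phil pha; case: lpaE => _ [_ brr _] brf _.
elim/tensors_rec: x f => [m|m x IHx|s x y IHx IHy] f.
- rewrite act_gen !ext_gen.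
  have phi0 : phi 0 = 0.
    by have := phil (-1) 0 0; rewrite scaler0 addr0 scaleN1r addNr.
  by have := phil f m 0; rewrite phi0 !addr0.
- by rewrite act_tens extB !ext_tens !IHx brf pha addrK.
- rewrite actP !extP IHx IHy scalerDr; congr (_ + _).
  by rewrite !restrictE !scalerA mulrC.
Qed.

Lemma ext_br x y : ext (br x y) = pl_bracket (ext x : E) (ext y : E).
Proof.
case: lpaE => _ [brl brr leib] _ _.
elim/tensors_rec: x y => [m|m x IHx|s x x' IHx IHx'] y.
- by rewrite freeLeib_bracket_gen ext_tens ext_gen.
- rewrite freeLeib_bracket_tens extB !ext_tens !IHx !ext_tens leib.
  by rewrite addrK.
- by rewrite freeLeib_bracketPl !extP IHx IHx' brl.
Qed.

Lemma ext_anchor x : pl_anchor (ext x : E) = Fa x.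
Proof.
case: phiP => phil pha; case: lpaE => al _ _ abr.
elim/tensors_rec: x => [m|m x IHx|s x x' IHx IHx'].
- by rewrite ext_gen pha freeLeib_anchor_gen.
- by rewrite ext_tens abr pha IHx freeLeib_anchor_tens.
- by rewrite extP (al (iota s)) IHx IHx' freeLeib_anchorP.
Qed.

End Universal.

Lemma FL_free : free_leibniz (@FL_incl R A iota M).
Proof.
split=> //; first exact: FL_leibniz.
  split=> [f m m'|m]; last exact: freeLeib_anchor_gen.
  rewrite /FL_incl /freeLeib_gen.
  have := proj1 (@word_multilinear _ MR) 1 (f *: m : M) m' [::].
  rewrite !scale1r => H; apply: (etrans H).
  by congr (_ + _); rewrite -[RHS]/(act f _) act_gen.
move=> E lpaE _ phi phiP; exists (ext phi); split.
  split; last by apply/funext => m; rewrite /= ext_gen.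
  split; last by move=> x y; rewrite ext_br.
  split=> [f x y|x]; last exact: ext_anchor.
  by rewrite (extD lpaE phiP) (ext_act lpaE phiP).
move=> Psi [[[Psil _] Psib] Psii]; apply/funext => x.
have phiE m : Psi (word (m : MR) [::]) = phi m by rewrite -Psii.
elim/tensors_rec: x => [m|m x IHx|s x x' IHx IHx'].
- by rewrite ext_gen // phiE.
- rewrite ext_tens // IHx -phiE -Psib /=.
  by rewrite freeLeib_bracket_gen.
- rewrite extP // IHx IHx'.
  have := Psil (iota s) x x'.
  rewrite -[(iota s *: _ : FL M)]/(act (iota s) x) act_iota => ->.
  by [].
Qed.
End FreeLeibnizTheory.

(* Main.v *)
Require Import Defs.
From HB Require Import structures.
From mathcomp Require Import all_boot all_algebra.
From mathcomp Require Import boolp classical_sets functions.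

(** Everything rests on the fact that J = J_1 + J_2 is a two-sided ideal of the
free Leibniz pseudoalgebra on which the anchor vanishes.  Once this is known,
the bracket and the anchor descend to the quotient, all axioms are inherited
through the surjection onto classes, the quotient is symmetric because the
symmetry defects were divided out, and the universal property follows from that
of the free Leibniz pseudoalgebra: the extension of an anchored map to a
symmetric target sends defects to defects, hence kills J.

The ideal property is a computation in any Leibniz pseudoalgebra E.

- The anchor of a symmetrized bracket is the sum of two opposite commutators,
  hence zero, and the anchor kills every defect ([anchor_sym_defect1],
  [anchor_sym_defect2]).

- Left multiplication by W is a derivation of the bracket, and over functions it
  acts through the anchor.  A defect is R-multilinear in f and in its other
  arguments, so W maps a defect to the sum of the defects where W is applied to
  one argument at a time ([bracket_sym_defect1], [bracket_sym_defect2]).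

- Right multiplication kills symmetrized brackets, by the Leibniz identity
  ([circ_bracket]), and therefore all defects ([sym_defect1_bracket],
  [sym_defect2_bracket]).

No axiom of a Leibniz pseudoalgebra expresses [f X, W] through [X, W], so the
last point does not yet show that J, which is generated by the defects as an
A-module, is stable under right multiplication.  Here the first family of
defects helps: modulo J it lets f move from one factor of X o W to the other, so
that [f X, W] is congruent to a combination of [X, f W] and of brackets with X
on the right ([scale_bracketE], [J_bracketl]). *)

Set Implicit Arguments.
Unset Strict Implicit.
Unset Printing Implicit Defensive.

Import GRing.Theory.
Local Open Scope ring_scope.

(** * Symmetry defects in a Leibniz pseudoalgebra *)

Section Defects.
Context (R A : comPzRingType) (iota : {rmorphism R -> A}).
Context (E : preLeibniz iota) (lpaE : leibniz_pseudoalgebra E).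
Implicit Types (X Y Z W : E) (f : A).

Lemma bracketDl X Y Z :
  pl_bracket (X + Y) Z = pl_bracket X Z + pl_bracket Y Z.
Proof.
case: lpaE => _ [brl _ _] _ _.
by have := brl 1 X Y Z; rewrite rmorph1 !scale1r.
Qed.

Lemma bracketDr X Y Z :
  pl_bracket X (Y + Z) = pl_bracket X Y + pl_bracket X Z.
Proof.
case: lpaE => _ [_ brr _] _ _.
by have := brr 1 X Y Z; rewrite rmorph1 !scale1r.
Qed.

Lemma bracketBl X Y Z :
  pl_bracket (X - Y) Z = pl_bracket X Z - pl_bracket Y Z.
Proof. by apply: (addIr (pl_bracket Y Z)); rewrite -bracketDl !subrK. Qed.

Lemma bracketBr X Y Z :
  pl_bracket X (Y - Z) = pl_bracket X Y - pl_bracket X Z.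
Proof. by apply: (addIr (pl_bracket X Z)); rewrite -bracketDr !subrK. Qed.

Lemma bracketr0 X : pl_bracket X 0 = 0.
Proof. by have := bracketBr X 0 0; rewrite !subrr. Qed.

Lemma bracketZr X f Y :
  pl_bracket X (f *: Y) = f *: pl_bracket X Y + pl_anchor X f *: Y.
Proof. by case: lpaE. Qed.

Lemma bracket_leibniz X Y Z :
  pl_bracket X (pl_bracket Y Z) =
  pl_bracket (pl_bracket X Y) Z + pl_bracket Y (pl_bracket X Z).
Proof. by case: lpaE => _ []. Qed.

Lemma circDl X Y Z : circ (X + Y) Z = circ X Z + circ Y Z.
Proof. by rewrite /circ bracketDl bracketDr addrACA. Qed.

Lemma circDr X Y Z : circ X (Y + Z) = circ X Y + circ X Z.
Proof. by rewrite /circ bracketDl bracketDr addrACA. Qed.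

Lemma bracket_circ W X Y :
  pl_bracket W (circ X Y) =
  circ (pl_bracket W X) Y + circ X (pl_bracket W Y).
Proof.
rewrite /circ bracketDr (bracket_leibniz W X) (bracket_leibniz W Y).
by rewrite [pl_bracket (pl_bracket W Y) X + _]addrC addrACA.
Qed.

(** By the Leibniz identity, [[X, Y], Z] is antisymmetric in X and Y. *)
Lemma circ_bracket X Y Z : pl_bracket (circ X Y) Z = 0.
Proof.
have bb U V : pl_bracket (pl_bracket U V) Z =
    pl_bracket U (pl_bracket V Z) - pl_bracket V (pl_bracket U Z).
  by rewrite bracket_leibniz addrK.
by rewrite /circ bracketDl !bb addrC subrKA subrr.
Qed.

Lemma sym_defect1_bracket f X Y Z : pl_bracket (sym_defect1 f X Y) Z = 0.
Proof. by rewrite bracketBl !circ_bracket subrr. Qed.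

Lemma sym_defect2_bracket f X Y Z W : pl_bracket (sym_defect2 f X Y Z) W = 0.
Proof.
have bb0 U : pl_bracket (pl_bracket U (circ Y Z)) W = 0.
  have := bracket_leibniz U (circ Y Z) W.
  by rewrite !circ_bracket bracketr0 addr0.
by rewrite /sym_defect2 !bracketBl !circ_bracket bb0 !subr0.
Qed.

Lemma bracket_sym_defect1 W f X Y :
  pl_bracket W (sym_defect1 f X Y) =
  sym_defect1 f (pl_bracket W X) Y + sym_defect1 f X (pl_bracket W Y) +
  sym_defect1 (pl_anchor W f : A) X Y.
Proof.
rewrite /sym_defect1 bracketBr !bracket_circ !bracketZr circDl circDr.
rewrite addrA [circ (f *: pl_bracket W X) Y + _ + _]addrAC.
have sub2 (x y z t : E) : (x + y) - (z + t) = (x - z) + (y - t).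
  by rewrite opprD addrACA.
by rewrite !sub2.
Qed.

Lemma bracket_sym_defect2 W f X Y Z :
  pl_bracket W (sym_defect2 f X Y Z) =
  sym_defect2 f (pl_bracket W X) Y Z + sym_defect2 f X (pl_bracket W Y) Z +
  sym_defect2 f X Y (pl_bracket W Z) +
  sym_defect2 (pl_anchor W f : A) X Y Z.
Proof.
rewrite /sym_defect2 !bracketBr (bracket_leibniz W (f *: X)) !(bracket_circ W).
rewrite (bracketDr (f *: X)) !(bracket_leibniz W X) !(bracketZr W).
rewrite bracketDl !circDl !circDr.
have sub3 (x y z t u v : E) :
    (x + y) - (z + t) - (u + v) = (x - z - u) + (y - t - v).
  by rewrite !opprD [x + y + _]addrACA [LHS]addrACA.
rewrite -!sub3; congr (_ - _ - _).
- by rewrite addrAC addrA.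
- by rewrite !addrA.
- by rewrite addrACA [X in X + _]addrC [X in _ + X]addrC addrA.
Qed.

Lemma anchorD X Y : pl_anchor (X + Y) = pl_anchor X + pl_anchor Y.
Proof.
by case: lpaE => al _ _ _; have := al 1 X Y; rewrite !scale1r.
Qed.

Lemma anchorB X Y : pl_anchor (X - Y) = pl_anchor X - pl_anchor Y.
Proof. by apply: (addIr (pl_anchor Y)); rewrite -anchorD !subrK. Qed.

Lemma anchor_circ X Y : pl_anchor (circ X Y) = 0.
Proof.
case: lpaE => _ _ _ abr; rewrite /circ anchorD !abr; apply: der_ext => g.
set d := pl_anchor X; set e := pl_anchor Y.
change (d (e g) - e (d g) + (e (d g) - d (e g)) = 0 :> A).
by rewrite subrKA subrr.
Qed.

Lemma anchor_sym_defect1 f X Y : pl_anchor (sym_defect1 f X Y) = 0.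
Proof. by rewrite anchorB !anchor_circ subrr. Qed.

Lemma anchor_sym_defect2 f X Y Z : pl_anchor (sym_defect2 f X Y Z) = 0.
Proof.
by rewrite !anchorB bracket_circ anchorD !anchor_circ addr0 !subrr.
Qed.

(** The defining relation of the first family of defects, solved for the bracket
in which f multiplies the left factor. *)
Lemma scale_bracketE f X W :
  pl_bracket (f *: X) W =
  pl_bracket X (f *: W) + pl_bracket (f *: W) X - pl_bracket W (f *: X)
  - sym_defect1 f X W.
Proof. by rewrite /sym_defect1 /circ opprB [_ - _ + _]addrC subrKA addrK. Qed.

Lemma bracket_mod_ideal (N : set E) X X' Y Y' :
    submodule N ->
    (forall W Z, N Z -> N (pl_bracket W Z)) ->
    (forall W Z, N Z -> N (pl_bracket Z W)) ->
  N (X - X') -> N (Y - Y') -> N (pl_bracket X Y - pl_bracket X' Y').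
Proof.
move=> [_ Nl] Nbr Nbl NX NY.
rewrite -(subrKA (pl_bracket X Y')) -bracketBl -bracketBr -[X in X + _]scale1r.
by apply: Nl; [apply: Nbr | apply: Nbl].
Qed.

End Defects.

(** * The ideal of symmetry defects *)

Section SymmetrizingIdeal.
Context (R A : comPzRingType) (iota : {rmorphism R -> A}).
Context (M : anchoredModule iota).
Local Open Scope classical_set_scope.
Local Notation F := (FL M).
Local Notation J := (@J R A iota M).
Local Notation lpaF := (FL_leibniz M).
Implicit Types (X Y Z W : F) (f : A).

Lemma JZD f X Y : J X -> J Y -> J (f *: X + Y).
Proof. exact: (J_submodule M).2. Qed.

Lemma JD X Y : J X -> J Y -> J (X + Y).
Proof. by move=> JX JY; rewrite -[X]scale1r; apply: JZD. Qed.

Lemma JB X Y : J X -> J Y -> J (X - Y).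
Proof. by move=> JX JY; rewrite addrC -scaleN1r; apply: JZD. Qed.

Lemma JZ f X : J X -> J (f *: X).
Proof.
by move=> JX; rewrite -[_ *: _]addr0; apply: JZD => //; case: (J_submodule M).
Qed.

Lemma J_sym_defect1 f X Y : J (sym_defect1 f X Y).
Proof.
exists (sym_defect1 f X Y); last first.
  by exists 0; rewrite ?addr0 //; case: (submodule_genP (@J2 _ _ _ M)).
by move=> N [_]; apply; exists f, X, Y.
Qed.

Lemma J_sym_defect2 f X Y Z : J (sym_defect2 f X Y Z).
Proof.
exists 0; first by case: (submodule_genP (@J1 _ _ _ M)).
exists (sym_defect2 f X Y Z); last by rewrite add0r.
by move=> N [_]; apply; exists f, X, Y, Z.
Qed.

Lemma J_least (N : set F) :
    submodule N ->
    (forall f X Y, N (sym_defect1 f X Y)) ->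
    (forall f X Y Z, N (sym_defect2 f X Y Z)) ->
  forall X, J X -> N X.
Proof.
move=> Nm N1 N2 _ [X JX [Y JY ->]]; rewrite -[X]scale1r.
apply: Nm.2; [apply: JX | apply: JY]; split=> //.
- by move=> _ [f [U [V ->]]].
- by move=> _ [f [U [V [W ->]]]].
Qed.

Lemma J_anchor X : J X -> pl_anchor X = 0.
Proof.
have al : linear (@pl_anchor _ _ _ F) by case: lpaF.
apply: (@J_least [set X | pl_anchor X = 0]); first split=> [|f Y Z Y0 Z0].
- by have := anchorB lpaF 0 0; rewrite !subrr.
- by apply: etrans (al f Y Z) _; rewrite Y0 Z0 scaler0 addr0.
- by move=> f Y Z; apply: (anchor_sym_defect1 lpaF).
- by move=> f Y Z U; apply: (anchor_sym_defect2 lpaF).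
Qed.

Lemma J_bracketr W X : J X -> J (pl_bracket W X).
Proof.
(* Without the condition J X, the term a(W)(f) X of [W, f X] would prevent N
   from being a submodule. *)
pose N := [set X | J X /\ forall W : F, J (pl_bracket W X)].
move=> JX; suff: N X by case.
apply: (@J_least N) JX; first split=> [|f U V [JU NU] [JV NV]].
- have J0 : J 0 by case: (J_submodule M).
  by split=> // W'; rewrite (bracketr0 lpaF).
- split=> [|W']; first exact: JZD.
  rewrite (bracketDr lpaF) (bracketZr lpaF).
  by apply: JD => //; apply: JD; apply: JZ.
- move=> f Y Z; split=> [|W']; first exact: J_sym_defect1.
  rewrite (bracket_sym_defect1 lpaF).
  by apply: JD; [apply: JD|]; apply: J_sym_defect1.
- move=> f Y Z U; split=> [|W']; first exact: J_sym_defect2.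
  rewrite (bracket_sym_defect2 lpaF).
  by apply: JD; [apply: JD; [apply: JD|]|]; apply: J_sym_defect2.
Qed.

(** The X in J with [X, W] in J for all W form a submodule: in [f X, W] the
scalar f can be moved to W by [scale_bracketE], and the correction terms are in
J by [J_bracketr].  This submodule contains the defects, for which [X, W] = 0. *)
Lemma J_bracketl X W : J X -> J (pl_bracket X W).
Proof.
pose N := [set X | J X /\ forall W : F, J (pl_bracket X W)].
move=> JX; suff: N X by case.
have J0 : J 0 by case: (J_submodule M).
apply: (@J_least N) JX; first split=> [|f U V [JU NU] [JV NV]].
- by split=> // W'; have := bracketBl lpaF 0 0 W'; rewrite !subrr => ->.
- split=> [|W']; first exact: JZD.
  rewrite (bracketDl lpaF) scale_bracketE; apply: JD => //.
  apply: JB; last exact: J_sym_defect1.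
  by apply: JB; [apply: JD => // |]; apply: J_bracketr => //; apply: JZ.
- move=> f Y Z; split=> [|W']; first exact: J_sym_defect1.
  by rewrite (sym_defect1_bracket lpaF).
- move=> f Y Z U; split=> [|W']; first exact: J_sym_defect2.
  by rewrite (sym_defect2_bracket lpaF).
Qed.

(** * The quotient *)

Lemma FSL_repr_class X : J (FSL_repr (FSL_class X) - X).
Proof. by apply/FSL_class_eqP; rewrite FSL_classK. Qed.

Lemma FSL_classP f X Y :
  FSL_class (f *: X + Y) = f *: (FSL_class X : FSL M) + FSL_class Y.
Proof. by rewrite FSL_classD -FSL_scaleE. Qed.

Lemma FSL_class_bracket X Y :
  pl_bracket (FSL_class X : FSL M) (FSL_class Y : FSL M) =
  FSL_class (pl_bracket X Y).
Proof.
apply/FSL_class_eqP; apply: (bracket_mod_ideal lpaF (J_submodule M)).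
- exact: J_bracketr.
- by move=> W Z; apply: J_bracketl.
- exact: FSL_repr_class.
- exact: FSL_repr_class.
Qed.

Lemma FSL_class_anchor X : pl_anchor (FSL_class X : FSL M) = pl_anchor X.
Proof.
apply/eqP; rewrite -subr_eq0 /= -(anchorB lpaF).
exact/eqP/J_anchor/FSL_repr_class.
Qed.

Lemma FSL_class_morphism : leibniz_morphism (@FSL_class _ _ _ M : F -> FSL M).
Proof.
split; last by move=> X Y; rewrite FSL_class_bracket.
by split; [exact: FSL_classP | exact: FSL_class_anchor].
Qed.

Lemma FSL_class_surj (P : FSL M -> Prop) :
  (forall X, P (FSL_class X)) -> forall x, P x.
Proof. by move=> PF x; rewrite -[x]FSL_classK. Qed.

End SymmetrizingIdeal.

(** * Morphisms *)

Section Morphisms.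
Context (R A : comPzRingType) (iota : {rmorphism R -> A}).
Context (E1 E2 : preLeibniz iota) (phi : E1 -> E2).
Context (phiP : leibniz_morphism phi).
Implicit Types (X Y Z : E1) (f : A).

Lemma morphismP f X Y : phi (f *: X + Y) = f *: phi X + phi Y.
Proof. by case: phiP => -[phil _] _; apply: phil. Qed.

Lemma morphismD X Y : phi (X + Y) = phi X + phi Y.
Proof. by have := morphismP 1 X Y; rewrite !scale1r. Qed.

Lemma morphismB X Y : phi (X - Y) = phi X - phi Y.
Proof. by apply: (addIr (phi Y)); rewrite -morphismD !subrK. Qed.

Lemma morphism0 : phi 0 = 0.
Proof. by have := morphismB 0 0; rewrite !subrr. Qed.

Lemma morphismZ f X : phi (f *: X) = f *: phi X.
Proof. by have := morphismP f X 0; rewrite morphism0 !addr0. Qed.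

Lemma morphism_bracket X Y : phi (pl_bracket X Y) = pl_bracket (phi X) (phi Y).
Proof. by case: phiP. Qed.

Lemma morphism_anchor X : pl_anchor (phi X) = pl_anchor X.
Proof. by case: phiP => -[_ pha] _; apply: pha. Qed.

Lemma morphism_circ X Y : phi (circ X Y) = circ (phi X) (phi Y).
Proof. by rewrite morphismD !morphism_bracket. Qed.

Lemma morphism_sym_defect1 f X Y :
  phi (sym_defect1 f X Y) = sym_defect1 f (phi X) (phi Y).
Proof. by rewrite morphismB !morphism_circ !morphismZ. Qed.

Lemma morphism_sym_defect2 f X Y Z :
  phi (sym_defect2 f X Y Z) = sym_defect2 f (phi X) (phi Y) (phi Z).
Proof.
rewrite !morphismB !morphism_circ morphism_bracket morphism_circ.
by rewrite !morphism_bracket !morphismZ.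
Qed.

(** Surjectivity is phrased as an induction principle, so that elimination
replaces each element of E2 by an image in one step. *)
Lemma leibniz_pseudoalgebra_surj :
  (forall P : E2 -> Prop, (forall X, P (phi X)) -> forall x, P x) ->
  leibniz_pseudoalgebra E1 -> leibniz_pseudoalgebra E2.
Proof.
move=> surj [al [brl brr leib] brf abr]; split.
- move=> f; elim/surj=> X; elim/surj=> Y.
  by rewrite -morphismP !morphism_anchor al.
- split=> [r|r|]; elim/surj=> X; elim/surj=> Y; elim/surj=> Z.
  + by rewrite -morphismP -!morphism_bracket brl morphismP.
  + by rewrite -morphismP -!morphism_bracket brr morphismP.
  + by rewrite -!morphism_bracket leib morphismD.
- move=> f; elim/surj=> X; elim/surj=> Y.
  rewrite -morphismZ -!morphism_bracket brf morphismP morphismZ.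
  by rewrite morphism_anchor.
- elim/surj=> X; elim/surj=> Y.
  by rewrite -morphism_bracket !morphism_anchor abr.
Qed.

End Morphisms.

(** * The universal property *)

Theorem proposition5p1 (R A : comPzRingType) (iota : {rmorphism R -> A})
    (M : anchoredModule iota) :
  [/\ forall X Y : FL M,
        pl_bracket (FSL_class X : FSL M) (FSL_class Y : FSL M) =
        FSL_class (pl_bracket X Y),
      forall X : FL M, pl_anchor (FSL_class X : FSL M) = pl_anchor X
    & free_symmetric_leibniz (@FSL_incl R A iota M)].
Proof.
have clM := FSL_class_morphism M.
have [_ _ [incll incla] univ] := FL_free M.
split; [exact: FSL_class_bracket | exact: FSL_class_anchor | split].
- apply: leibniz_pseudoalgebra_surj clM _ (FL_leibniz M).
  exact: FSL_class_surj.
- split=> f; elim/FSL_class_surj=> X; elim/FSL_class_surj=> Y.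
    rewrite -(morphism_sym_defect1 clM) -(morphism0 clM).
    by apply/FSL_class_eqP; rewrite subr0; apply: J_sym_defect1.
  elim/FSL_class_surj=> Z; rewrite -(morphism_sym_defect2 clM) -(morphism0 clM).
  by apply/FSL_class_eqP; rewrite subr0; apply: J_sym_defect2.
- split=> [f m m'|m]; first by rewrite /FSL_incl incll FSL_classP.
  by rewrite FSL_class_anchor incla.
move=> E lpaE [symE1 symE2] phi phiP.
have [Phi [[PhiM Phii] Phiuniq]] := univ E lpaE I phi phiP.
have PhiJ X : J X -> Phi X = 0.
  apply: (@J_least _ _ _ _ [set X | Phi X = 0]);
    first split=> [|f Y Z /= Y0 Z0].
  - exact: morphism0 PhiM.
  - by rewrite (morphismD PhiM) (morphismZ PhiM) Y0 Z0 scaler0 addr0.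
  - by move=> f Y Z; rewrite /= (morphism_sym_defect1 PhiM) symE1.
  - by move=> f Y Z U; rewrite /= (morphism_sym_defect2 PhiM) symE2.
pose Psi (x : FSL M) : E := Phi (FSL_repr x).
have PsiE X : Psi (FSL_class X) = Phi X.
  apply/eqP; rewrite -subr_eq0 -(morphismB PhiM).
  exact/eqP/PhiJ/FSL_repr_class.
exists Psi; split.
  split; last by apply/funext => m; rewrite /= PsiE -Phii.
  split; first split.
  - move=> f; elim/FSL_class_surj=> X; elim/FSL_class_surj=> Y.
    by rewrite -FSL_classP !PsiE (morphismD PhiM) (morphismZ PhiM).
  - elim/FSL_class_surj=> X.
    by rewrite PsiE (morphism_anchor PhiM) FSL_class_anchor.
  - elim/FSL_class_surj=> X; elim/FSL_class_surj=> Y.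
    by rewrite FSL_class_bracket !PsiE (morphism_bracket PhiM).
move=> Psi' [Psi'M Psi'i]; apply/funext; elim/FSL_class_surj=> X.
rewrite PsiE.
suff -> : Phi = Psi' \o (@FSL_class _ _ _ M : FL M -> FSL M) by [].
(* A morphism on the quotient is determined by its composite with the class map,
   to which the uniqueness part for the free Leibniz pseudoalgebra applies. *)
apply: Phiuniq; split=> //; split; first split.
- move=> f Y Z /=; rewrite FSL_classP.
  by rewrite (morphismD Psi'M) (morphismZ Psi'M).
- by move=> Y /=; rewrite (morphism_anchor Psi'M) FSL_class_anchor.
- by move=> Y Z /=; rewrite -(morphism_bracket Psi'M) FSL_class_bracket.
Qed.
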